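(* Let $\phi\colon\Gamma\to\mathbf{R}$ be a function on a group $\Gamma$. The following are equivalent: (1) $\phi$ is abstractly Lipschitz; (2) there exists a length function $|\cdot|$ on $\Gamma$ such that $\phi$ is Lipschitz with respect to $|\cdot|$.
   Context: A function $\phi\colon\Gamma\to\mathbf{R}$ is called abstractly Lipschitz if for each fixed $h\in\Gamma$ one has $\sup_{g\in\Gamma}|\phi(gh)-\phi(g)|<\infty$. A length function on $\Gamma$ is a function $|\cdot|\colon\Gamma\to[0,\infty)$ with $|1|=0$, $|g^{-1}|=|g|$ and $|gh|\le|g|+|h|$ for all $g,h\in\Gamma$ (it is allowed to vanish on nontrivial elements). A function $\phi$ is Lipschitz with respect to $|\cdot|$ if it is Lipschitz with respect to the left-invariant pseudometric $d(g,h)=|g^{-1}h|$, i.e. there is a constant $C\geq 0$ with $|\phi(gh)-\phi(g)|\le C|h|$ for all $g,h\in\Gamma$. *)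

(* Defs.v *)
From HB Require Import structures.
From mathcomp Require Import all_boot all_order all_algebra.
From mathcomp Require Import boolp classical_sets reals constructive_ereal ereal.

Set Implicit Arguments.
Unset Strict Implicit.
Unset Printing Implicit Defensive.

Import Order.TTheory GRing.Theory Num.Theory.

Local Open Scope classical_set_scope.
Local Open Scope ring_scope.

(* The supremum is taken in the extended reals, so that finiteness is a genuine
   condition (the real-valued [sup] of an unbounded set is a junk value). *)
Definition abstractly_lipschitz (R : realType) (Gamma : groupType)
    (phi : Gamma -> R) : Prop :=
  forall h : Gamma,
    (ereal_sup [set (`|phi (g * h)%g - phi g|)%:E | g in [set: Gamma]]
      < +oo)%E.

Record is_length_function (R : realType) (Gamma : groupType)
    (ell : Gamma -> R) : Prop := IsLengthFunction {
  length_ge0 : forall g : Gamma, 0 <= ell g;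
  length1 : ell 1%g = 0;
  lengthV : forall g : Gamma, ell (g^-1)%g = ell g;
  lengthM : forall g h : Gamma, ell (g * h)%g <= ell g + ell h
}.

(* Lipschitz for the left-invariant pseudometric [ell (g^-1 * g')], written
   with [g' = g * h]. *)
Definition lipschitz_wrt_length (R : realType) (Gamma : groupType)
    (ell phi : Gamma -> R) : Prop :=
  exists2 C : R, 0 <= C &
    forall g h : Gamma, `|phi (g * h)%g - phi g| <= C * ell h.

(* Main.v *)
Require Import Defs.
From mathcomp Require Import all_boot all_order all_algebra.
From mathcomp Require Import reals.
From mathcomp Require Import classical_sets constructive_ereal ereal.

(** The sup norm of the displacement of [phi] under right translation by [h],
    [ell h = sup_g `|phi (g * h) - phi g|], is itself the length function:
    abstract Lipschitzness says exactly that it is finite.  It is invariant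
    under [h |-> h^-1] and subadditive because [g] ranges over the whole group:
    substituting [g * h^-1] for [g], respectively passing through the
    intermediate point [g * h], only moves the base point of the supremum.  By
    construction [phi] is 1-Lipschitz for [ell].  Conversely, a Lipschitz bound
    [C * ell h] does not depend on [g], so it bounds the supremum at [h]. *)

Set Implicit Arguments.
Unset Strict Implicit.
Unset Printing Implicit Defensive.

Import Order.TTheory GRing.Theory Num.Theory.

Local Open Scope classical_set_scope.
Local Open Scope ring_scope.

Definition displacement (R : realType) (Gamma : groupType) (phi : Gamma -> R)
    (h : Gamma) : R :=
  fine (ereal_sup
    [set (`|phi (g * h)%g - phi g|)%:E | g in [set: Gamma]]).

(** Finiteness of the extended supremum, needed to read its real part, has two
    halves: the hypothesis excludes [+oo], and the term at [g = 1] excludes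
    [-oo]. *)
Lemma displacementE (R : realType) (Gamma : groupType) (phi : Gamma -> R) :
  abstractly_lipschitz phi -> forall h : Gamma,
  (displacement phi h)%:E =
  ereal_sup [set (`|phi (g * h)%g - phi g|)%:E | g in [set: Gamma]].
Proof.
move=> phi_lip h; rewrite /displacement fineK// fin_real// phi_lip andbT.
apply: (@lt_le_trans _ _ (`|phi (1 * h)%g - phi 1%g|)%:E); first exact: ltNyr.
by apply: ereal_sup_ubound; exists 1%g.
Qed.

Lemma displacement_ub (R : realType) (Gamma : groupType) (phi : Gamma -> R) :
  abstractly_lipschitz phi -> forall g h : Gamma,
  `|phi (g * h)%g - phi g| <= displacement phi h.
Proof.
move=> phi_lip g h; rewrite -lee_fin displacementE//.
by apply: ereal_sup_ubound; exists g.
Qed.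

Lemma displacement_le (R : realType) (Gamma : groupType) (phi : Gamma -> R) :
  abstractly_lipschitz phi -> forall (h : Gamma) (c : R),
  (forall g : Gamma, `|phi (g * h)%g - phi g| <= c) ->
  displacement phi h <= c.
Proof.
move=> phi_lip h c phi_le; rewrite -lee_fin displacementE//.
by apply: ge_ereal_sup => _ [g _ <-]; rewrite lee_fin.
Qed.

(** The axioms are checked one base point at a time; symmetry reduces to the
    inequality for [h^-1], which applied twice gives the equality. *)
Lemma displacement_length (R : realType) (Gamma : groupType)
    (phi : Gamma -> R) :
  abstractly_lipschitz phi ->
  is_length_function (displacement phi).
Proof.
move=> phi_lip.
have ub := displacement_ub phi_lip.
have le := displacement_le phi_lip.
have ge0 h : 0 <= displacement phi h.
  exact: le_trans (normr_ge0 _) (ub 1%g h).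
have leV h : displacement phi h^-1%g <= displacement phi h.
  apply: le => g.
  (* Moving by [h] from the base point [g * h^-1] leads back to [g]. *)
  by have := ub (g * h^-1)%g h; rewrite mulgVK distrC.
split => //.
- apply/eqP; rewrite eq_le ge0 andbT; apply: le => g.
  by rewrite mulg1 subrr normr0.
- move=> h; apply/eqP; rewrite eq_le leV /=.
  by have := leV h^-1%g; rewrite invgK.
- move=> h k; apply: le => g.
  (* The path from [g] to [g * (h * k)] is cut at [g * h]. *)
  apply: le_trans (ler_distD (phi (g * h)%g) _ _) _.
  by rewrite addrC lerD ?ub// mulgA ub.
Qed.

Theorem proposition4p2 (R : realType) (Gamma : groupType) (phi : Gamma -> R) :
  abstractly_lipschitz phi <->
  exists ell : Gamma -> R,
    is_length_function ell /\ lipschitz_wrt_length ell phi.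
Proof.
split=> [phi_lip | [ell [_ [C _ phi_le]]] h].
  exists (displacement phi).
  split; first exact: displacement_length.
  by exists 1 => // g h; rewrite mul1r; exact: displacement_ub.
apply: (@le_lt_trans _ _ (C * ell h)%:E); last exact: ltry.
by apply: ge_ereal_sup => _ [g _ <-]; rewrite lee_fin.
Qed.
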